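(* Fix a single-starred motif specification on $p,L$. Then, as $r\to\infty$, the maximum of $\mathcal M(\mathcal S)$ over sets $\mathcal S\subseteq\mathbb{R}^p$ of size $r$ is asymptotic to $\mathcal C\,r^L$. Moreover, there is $r_0$ such that if $r\ge r_0$ and $\mathcal S\subseteq\mathbb{R}^p$ of size $r$ attains this maximum, then $\mathcal S$ has exactly one center, this center is also a hypercenter, every point of $\mathcal S$ is in line with it, and $\mathcal S\subseteq\ell_1\cup\cdots\cup\ell_q$, where each $\ell_j$ is a line of the form $\{x\in\mathbb{R}^p: x_m=c^{(j)}_m \text{ for all } m\ne C_j\}$ for some reals $c^{(j)}_m$.
   Context: A single-starred motif specification on $p,L$ is a sequence of partitions $\pi_1,\dots,\pi_p$ of $\{1,\dots,L\}$ such that for each $i$ there is exactly one $m$ with $\{i\}$ a block of $\pi_m$. A tuple $(f_1,\dots,f_L)\in(\mathbb{R}^p)^L$ is a motif if whenever $i,j$ lie in the same block of $\pi_m$, $(f_i)_m=(f_j)_m$; $\mathcal M(\mathcal S)$ counts $L$-tuples of elements of $\mathcal S$ (repetitions allowed) that are motifs. Let $C_1,\dots,C_q$ be the distinct indices $m$ for which $\pi_m$ has a singleton block, $\alpha_j>0$ the number of singleton blocks of $\pi_{C_j}$, and $\mathcal C=\alpha_1^{\alpha_1}\cdots\alpha_q^{\alpha_q}/L^L$. Let $k$ be the total number of non-singleton blocks among all $\pi_m$; $v\in\mathbb{R}^k$ assigns a real value to each such block. For $v\in\mathbb{R}^k$ and $i\in\{1,\dots,L\}$, $f_i(v)\in(\mathbb{R}\cup\{*\})^p$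 has $m$-th coordinate $*$ if $\{i\}$ is a block of $\pi_m$, and otherwise the value $v$ assigns to the block of $\pi_m$ containing $i$. For $w\in(\mathbb{R}\cup\{*\})^p$, $N_{\mathcal S}(w)$ is the number of points of $\mathcal S$ agreeing with $w$ in every non-$*$ coordinate. Let $M_1(L)=L(L^L+1)$, $M(L)=(2M_1(L))^{L-1}L^2+1$. For $\mathcal S$ of size $r$: $v$ is a center if at least $L-1$ of $N_{\mathcal S}(f_1(v)),\dots,N_{\mathcal S}(f_L(v))$ are $\ge r/M(L)$; $v$ is a hypercenter if all of them are $\ge r/M_1(L)$. A point $w\in\mathbb{R}^p$ is in line with $v$ if for some $i$, $w$ agrees with $f_i(v)$ in every coordinate where $f_i(v)$ is not $*$. *)

(* Defs.v *)
From HB Require Import structures.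
From mathcomp Require Import all_boot all_order all_algebra finmap.
From mathcomp Require Import reals.

Set Implicit Arguments.
Unset Strict Implicit.
Unset Printing Implicit Defensive.

Import Order.TTheory GRing.Theory Num.Theory.

Local Open Scope fset_scope.
Local Open Scope ring_scope.

(* Points of R^p are row vectors; the m-th coordinate of x is [x 0 m].  The
   indices {1, ..., p} and {1, ..., L} are shifted to 'I_p and 'I_L. *)

Definition single_starred (p L : nat) (pi : 'I_p -> {set {set 'I_L}}) : Prop :=
  (forall m, partition (pi m) [set: 'I_L]) /\
  (forall i : 'I_L, exists! m : 'I_p, [set i]%SET \in pi m).

Definition is_motif (R : realType) (p L : nat) (pi : 'I_p -> {set {set 'I_L}})
    (f : 'I_L -> 'rV[R]_p) : bool :=
  [forall m, forall B in pi m, forall i in B, forall j in B,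
     f i 0 m == f j 0 m].

Definition motif_count (R : realType) (p L : nat)
    (pi : 'I_p -> {set {set 'I_L}}) (S : {fset 'rV[R]_p}) : nat :=
  #|[set f : {ffun 'I_L -> S} | is_motif pi (fun i => val (f i))]%SET|.

Definition is_max_motif_count (R : realType) (p L : nat)
    (pi : 'I_p -> {set {set 'I_L}}) (r n : nat) : Prop :=
  (exists S : {fset 'rV[R]_p}, #|` S| = r /\ motif_count pi S = n) /\
  (forall S : {fset 'rV[R]_p}, #|` S| = r -> (motif_count pi S <= n)%N).

Definition singleton_blocks (p L : nat) (pi : 'I_p -> {set {set 'I_L}}) (m : 'I_p) :
    {set {set 'I_L}} :=
  [set B in pi m | #|B| == 1%N]%SET.

(* The set {C_1, ..., C_q}. *)
Definition starred (p L : nat) (pi : 'I_p -> {set {set 'I_L}}) : {set 'I_p} :=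
  [set m | singleton_blocks pi m != set0]%SET.

(* The family (alpha_j) is indexed by the elements C_j of [starred pi]
   themselves rather than by j. *)
Definition motif_const (R : realType) (p L : nat)
    (pi : 'I_p -> {set {set 'I_L}}) : R :=
  (\prod_(m in starred pi) #|singleton_blocks pi m| ^ #|singleton_blocks pi m|)%N%:R
  / (L ^ L)%N%:R.

(* Non-singleton blocks, tagged by the index of their partition: a set that is
   a block of several partitions is counted once for each of them.  The
   cardinality of this type is k. *)
Definition block (p L : nat) (pi : 'I_p -> {set {set 'I_L}}) : Type :=
  {mB : 'I_p * {set 'I_L} | (mB.2 \in pi mB.1) && (#|mB.2| != 1%N)}.

(* [None] plays the role of the star.  When [pi m] is a partition of 'I_L and
   {i} is not a block, [pblock (pi m) i] is a non-singleton block, so [insub]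
   succeeds and its default [None] is not reached. *)
Definition fvec (R : realType) (p L : nat) (pi : 'I_p -> {set {set 'I_L}})
    (v : {ffun block pi -> R}) (i : 'I_L) (m : 'I_p) : option R :=
  if [set i]%SET \in pi m then None
  else omap v (insub (m, pblock (pi m) i)).

Definition agrees (R : realType) (p : nat) (w : 'I_p -> option R)
    (x : 'rV[R]_p) : bool :=
  [forall m, if w m is Some a then x 0 m == a else true].

Definition agree_count (R : realType) (p : nat) (S : {fset 'rV[R]_p})
    (w : 'I_p -> option R) : nat :=
  #|` [fset x in S | agrees w x]|.

Definition M1 (L : nat) : nat := (L * (L ^ L + 1))%N.

Definition M (L : nat) : nat := ((2 * M1 L) ^ (L - 1) * L ^ 2 + 1)%N.

Definition is_center (R : realType) (p L : nat)
    (pi : 'I_p -> {set {set 'I_L}}) (S : {fset 'rV[R]_p})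
    (v : {ffun block pi -> R}) : Prop :=
  (L - 1 <= #|[set i : 'I_L |
     #|` S|%:R / (M L)%:R <= (agree_count S (fvec v i))%:R :> R]%SET|)%N.

Definition is_hypercenter (R : realType) (p L : nat)
    (pi : 'I_p -> {set {set 'I_L}}) (S : {fset 'rV[R]_p})
    (v : {ffun block pi -> R}) : Prop :=
  forall i : 'I_L,
    #|` S|%:R / (M1 L)%:R <= (agree_count S (fvec v i))%:R :> R.

Definition in_line (R : realType) (p L : nat) (pi : 'I_p -> {set {set 'I_L}})
    (v : {ffun block pi -> R}) (x : 'rV[R]_p) : Prop :=
  exists i : 'I_L, agrees (fvec v i) x.

(* Main.v *)
Require Import Defs.
From HB Require Import structures.
From mathcomp Require Import all_boot all_order all_algebra finmap.
From mathcomp Require Import ring lra zify.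
From mathcomp Require Import reals.
From mathcomp Require boolp.

Set Implicit Arguments.
Unset Strict Implicit.
Unset Printing Implicit Defensive.

Import Order.TTheory GRing.Theory Num.Theory.

Local Open Scope fset_scope.
Local Open Scope ring_scope.

(* For each i let s(i) be the index with {i} a block of pi_{s(i)}.  All points
   of a motif but the i-th determine the i-th up to its coordinate s(i), so at
   most r^L / K motifs have fewer than r/K points of S on the line of direction
   s(i) through f_i.  In the other motifs f_i lies in the set H_{s(i)} of points
   on heavy lines of direction s(i).  Heavy sets of different directions meet in
   at most K^2 points, so sum_m |H_m| <= r + O(1), and AM-GM bounds
   prod_i |H_{s(i)}| by C (r + O(1))^L; points spread over the coordinate axes
   attain C r^L asymptotically.  The bound counts all tuples of points on heavy
   lines, so a maximal S cannot have a positive proportion of such tuples that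
   are not motifs: this makes the center unique and its lines of equal direction
   coincide.  Finally, a point not in line with the center is in too few motifs
   to compete with a new point on one of the center's lines. *)

(** * Finite tuples *)

Lemma card_set_family (I T : finType) (F : I -> {set T}) :
  #|[set f : {ffun I -> T} | [forall i, f i \in F i]]%SET| = (\prod_i #|F i|)%N.
Proof.
transitivity #|family (fun i => mem (F i))|.
  apply: eq_card => f; rewrite inE.
  by apply/forallP/familyP => h i; apply: h.
by rewrite card_family foldrE big_image.
Qed.

(** Group [A] by all coordinates but [i0]: each group has at most [r / K] members, and the groups
    are indexed by tuples in the product of the other [F i]. *)
Lemma leq_card_fibers (I T : finType) (A : {set {ffun I -> T}}) (F : I -> {set T})
    (i0 : I) (K r : nat) :
  (forall f i, f \in A -> f i \in F i) ->
  (forall f, f \in A ->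
    K * #|[set g in A | [forall i, (i != i0) ==> (g i == f i)]]%SET| <= r)%N ->
  (K * #|A| <= r * \prod_(i | i != i0) #|F i|)%N.
Proof.
move=> AF Ar.
have [->|[f0 f0A]] := set_0Vmem A; first by rewrite cards0 muln0.
(* Overwriting coordinate [i0] by a fixed value keeps [rho] inside the same type; the factor at [i0]
   then has size 1. *)
pose rho (f : {ffun I -> T}) := [ffun i => if i == i0 then f0 i0 else f i].
pose F' i := if i == i0 then [set f0 i0]%SET else F i.
have -> : (\prod_(i | i != i0) #|F i| = \prod_i #|F' i|)%N.
  rewrite [RHS](bigD1 i0) //= /F' eqxx cards1 mul1n.
  by apply: eq_bigr => i /negPf ->.
rewrite -card_set_family -[in #|A|]sum1_card.
rewrite (partition_big_imset rho) big_distrr /=.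
apply: (@leq_trans (\sum_(g in rho @: A) r)); last first.
  rewrite sum_nat_const mulnC leq_mul2l; apply/orP; right.
  apply/subset_leq_card/subsetP => _ /imsetP[f fA ->]; rewrite inE; apply/forallP => i.
  by rewrite ffunE /F'; case: ifP; rewrite ?inE// AF.
apply: leq_sum => _ /imsetP[f fA ->]; apply: leq_trans (Ar f fA).
rewrite leq_mul2l -sum1_card; apply/orP; right.
rewrite [leqRHS](eq_bigl (fun g => (g \in A) && [forall i, (i != i0) ==> (g i == f i)])); last first.
  by move=> g; rewrite inE.
rewrite big_mkcond [leqRHS]big_mkcond; apply: leq_sum => g _ /=.
case: (g \in A) => //=; case: eqP => // /ffunP e.
have -> //: [forall i, (i != i0) ==> (g i == f i)].
by apply/forallP => i; apply/implyP => /negPf ni; have := e i; rewrite !ffunE ni => ->.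
Qed.

Lemma card_inj_imfset (T : finType) (K : choiceType) (h : T -> K) (A : {set T}) :
  injective h -> #|` [fset h x | x in A]| = #|A|.
Proof. by move=> hi; rewrite card_imfset //= -cardE. Qed.

Section Tuples.
Variables (I : finType) (K : choiceType).
Implicit Types S : {fset K}.

(** The values lie in [K] and not in the subtype [S], so tuples over different sets can be
    compared. *)
Definition tuples S : {fset {ffun I -> K}} :=
  [fset [ffun i => val (f i)] | f : {ffun I -> S} in {: {ffun I -> S}}].

Lemma in_tuples S (f : {ffun I -> K}) : (f \in tuples S) = [forall i, f i \in S].
Proof.
apply/imfsetP/forallP => /= [[g _ ->] i|fS]; first by rewrite ffunE; apply: valP.
by exists [ffun i => [` fS i]] => //; apply/ffunP => i; rewrite !ffunE.
Qed.

Lemma card_tuples S (Q : pred {ffun I -> K}) :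
  #|` [fset f in tuples S | Q f]| =
  #|[set f : {ffun I -> S} | Q [ffun i => val (f i)]]%SET|.
Proof.
have injv : injective (fun f : {ffun I -> S} => [ffun i => val (f i)]).
  by move=> f g /ffunP e; apply/ffunP => i; apply: val_inj; have := e i; rewrite !ffunE.
rewrite -(card_inj_imfset _ injv).
congr #|` _|; apply/fsetP => f; rewrite !inE; apply/andP/imfsetP => /=.
  by move=> [/imfsetP[g _ ->] Qf]; exists g => //; rewrite inE.
by move=> [g gQ ->]; rewrite mem_imfset //=; split=> //; move: gQ; rewrite inE.
Qed.

Lemma card_tuples_family S (P : I -> pred K) :
  #|` [fset f in tuples S | [forall i, P i (f i)]]| =
  (\prod_i #|[set x : S | P i (val x)]%SET|)%N.
Proof.
rewrite card_tuples -card_set_family; congr #|pred_of_set _|; apply/setP => f.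
by rewrite !inE; apply: eq_forallb => i; rewrite ffunE inE.
Qed.

End Tuples.

Lemma card_fset_pred (K : choiceType) (S : {fset K}) (P : pred K) :
  #|` [fset x in S | P x]| = #|[set x : S | P (val x)]%SET|.
Proof.
rewrite -(card_inj_imfset _ val_inj).
congr #|` _|; apply/fsetP => x; rewrite !inE; apply/andP/imfsetP => /=.
  by move=> [xS Px]; exists [` xS] => //; rewrite inE.
by move=> [y yP ->]; split; [apply: valP | move: yP; rewrite inE].
Qed.

(** * Heavy lines *)

Lemma leq_card_cover_family (I T : finType) (A : {set T}) (P : I -> {set T}) :
  (forall x, x \in A -> exists i, x \in P i) -> (#|A| <= \sum_i #|P i|)%N.
Proof.
move=> AP; apply: (@leq_trans #|\bigcup_i P i|%SET).
  by apply/subset_leq_card/subsetP => x /AP[i xi]; apply/bigcupP; exists i.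
elim/big_rec2: _ => [|i A1 n _ h]; first by rewrite cards0.
by apply: leq_trans (leq_card_setU _ _) _; rewrite leq_add2l.
Qed.

Lemma prod_card_const (L : nat) (S : finType) (i0 : 'I_L) :
  (#|S| * \prod_(i | i != i0) #|[set: S]|%SET = #|S| ^ L)%N.
Proof.
rewrite prod_nat_const cardC1 card_ord cardsT -expnS prednK //.
exact: leq_ltn_trans (ltn_ord i0).
Qed.

Section Lines.
Variables (R : realType) (p : nat).
Local Notation point := 'rV[R]_p.
Implicit Types (S : {fset point}) (m : 'I_p) (c x : point).

Definition on_line m c x : bool :=
  [forall m', (m' != m) ==> (x 0 m' == c 0 m')].

Lemma on_lineP m c x :
  reflect (forall m', m' != m -> x 0 m' = c 0 m') (on_line m c x).
Proof.
apply: (iffP forallP) => h m'; first by move=> mm; apply/eqP/(implyP (h m')).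
by apply/implyP => mm; rewrite h.
Qed.

Lemma on_line_base m c x y : on_line m c x -> on_line m c y = on_line m x y.
Proof.
move=> /on_lineP h; apply: eq_forallb => m'.
by case: eqVneq => //= /h ->.
Qed.

Definition line_count S m c : nat := #|[set x : S | on_line m c (val x)]%SET|.

Lemma line_count_base S m c x : on_line m c x -> line_count S m x = line_count S m c.
Proof.
by move=> cx; apply: eq_card => y; rewrite !inE (on_line_base _ cx).
Qed.

(** Division-free form of a line containing at least [#|S| / K] points of [S]. *)
Definition heavy S K m : {set S} := [set x : S | (#|` S| <= K * line_count S m (val x))%N]%SET.

(** Double counting: a point [x] of both heavy sets yields at least [(#|S| / K)^2] pairs, one member
    on each of its two lines. A pair determines [x], whose coordinates other than [m] come from the
    first member and whose [m]-th comes from the second. *)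
Lemma card_heavyI S K m m' : m != m' -> (#|heavy S K m :&: heavy S K m'|%SET <= K ^ 2)%N.
Proof.
move=> mm'; set X := (_ :&: _)%SET.
have [S0|S_gt0] := posnP #|` S|.
  by rewrite (leq_trans (max_card _)) // -cardfE S0.
pose Y (x : S) := setX [set y : S | on_line m (val x) (val y)]%SET
                       [set y : S | on_line m' (val x) (val y)]%SET.
have Ybound : (\sum_(x in X) #|Y x| <= #|` S| ^ 2)%N.
  have -> : (#|` S| ^ 2 = \sum_(y : S * S) 1)%N.
    by rewrite sum1_card card_prod cardfE mulnn.
  under eq_bigr do rewrite -sum1_card.
  rewrite (exchange_big_dep predT) //=; apply: leq_sum => -[y y'] _.
  rewrite sum1_card; apply/card_le1_eqP => x z /andP[_ xY] /andP[_ zY].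
  move: xY zY; rewrite !in_setX !inE /=.
  move=> /andP[/on_lineP xy /on_lineP xy'] /andP[/on_lineP zy /on_lineP zy'].
  apply/esym/val_inj/rowP => k; have [km|km] := eqVneq k m; last by rewrite -xy // zy.
  by rewrite -xy' ?zy' // km.
have : (\sum_(x in X) #|` S| ^ 2 <= \sum_(x in X) K ^ 2 * #|Y x|)%N.
  apply: leq_sum => x; rewrite !inE => /andP[hx hx'].
  by rewrite cardsX -mulnn -mulnn mulnACA leq_mul.
rewrite sum_nat_const -big_distrr /= => h.
rewrite -(@leq_pmul2r (#|` S| ^ 2)) ?expn_gt0 ?S_gt0 //.
by apply: leq_trans h _; rewrite leq_mul2l Ybound orbT.
Qed.

Lemma sum_card_heavy S K :
  (\sum_m #|heavy S K m| <= #|` S| + (p * p) * K ^ 2)%N.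
Proof.
pose I2 m m' : {set S} := if m != m' then (heavy S K m :&: heavy S K m')%SET else set0.
have I2le : (\sum_m \sum_m' #|I2 m m'| <= (p * p) * K ^ 2)%N.
  apply: (@leq_trans (\sum_(m < p) \sum_(m' < p) K ^ 2)); last first.
    by rewrite !sum_nat_const card_ord mulnA.
  apply: leq_sum => m _; apply: leq_sum => m' _.
  by rewrite /I2; case: ifP => [/card_heavyI //|_]; rewrite cards0.
apply: leq_trans (leq_add (leqnn _) I2le).
rewrite cardfE -sum1_card.
under eq_bigr do rewrite -sum1_card big_mkcond /=.
under [X in (_ <= _ + X)%N]eq_bigr do under eq_bigr do rewrite -sum1_card big_mkcond /=.
under [X in (_ <= _ + X)%N]eq_bigr do rewrite exchange_big /=.
rewrite exchange_big [X in (_ <= _ + X)%N]exchange_big -big_split /=.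
apply: leq_sum => x _.
(* One heavy direction [m0] of [x] is paid for by [#|S|]; every further one, [m], is charged to the
   ordered pair [(m0, m)]. *)
have [m0 xm0|no] := pickP (fun m => x \in heavy S K m); last first.
  by rewrite big1 // => m _; rewrite no.
rewrite (bigD1 m0) //= ifT // leq_add2l.
rewrite [leqRHS](bigD1 m0) //=; apply: leq_trans (leq_addr _ _).
rewrite big_mkcond /=; apply: leq_sum => m _.
by rewrite /I2 eq_sym; case: ifP => // _; rewrite in_setI [X in X && _]xm0.
Qed.

End Lines.

(** AM-GM for the numbers [h (s i) / a (s i)], with [a j] the size of the fibre of [s] over [j]: the
    [a j] equal terms over [j] add up to [h j]. *)
Lemma prod_AGM (I J : finType) (s : I -> J) (h : J -> nat) :
  (#|I| ^ #|I| * \prod_i h (s i)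
     <= \prod_i #|[set j | s j == s i]%SET| * (\sum_j h j) ^ #|I|)%N.
Proof.
pose a j := #|[set i | s i == j]%SET|.
have a_gt0 i : (0 < a (s i))%N by rewrite card_gt0; apply/set0Pn; exists i; rewrite inE.
have [I0|I_gt0] := posnP #|I|.
  by rewrite I0 !expn0 mul1n muln1 !big_pred0 // => i; move: (fintype0 i I0).
pose E i : rat := (h (s i))%:R / (a (s i))%:R.
have E_ge0 : {in I, forall i, 0 <= E i} by move=> i _; rewrite divr_ge0.
have sumE : \sum_i E i <= (\sum_j h j)%:R.
  rewrite (partition_big s predT) //= natr_sum; apply: ler_sum => j _.
  rewrite (eq_bigr (fun=> (h j)%:R / (a j)%:R)); last by move=> i /eqP <-.
  rewrite sumr_const.
  have -> : #|[pred i | s i == j]| = a j by apply: eq_card => i; rewrite !inE.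
  have [->|aj] := posnP (a j); first by rewrite mulr0n ler0n.
  by rewrite -[X in X <= _]mulr_natr divfK // pnatr_eq0 -lt0n.
have [AGM _] := leif_AGM E_ge0.
rewrite -(ler_nat rat) !natrM !natrX !natr_prod.
have -> : \prod_i (h (s i))%:R = \prod_i (a (s i))%:R * \prod_i E i :> rat.
  rewrite -big_split; apply: eq_bigr => i _ /=.
  by rewrite mulrC divfK // pnatr_eq0 -lt0n.
rewrite mulrCA ler_wpM2l ?prodr_ge0 //.
rewrite -ler_pdivlMl ?exprn_gt0 ?ltr0n // mulrC -exprVn -exprMn.
apply: le_trans AGM _; apply: lerXn2r.
- by rewrite nnegrE divr_ge0 ?sumr_ge0 // => i _; apply: E_ge0.
- by rewrite nnegrE mulr_ge0 // ?invr_ge0 ler0n.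
- by rewrite ler_wpM2r // invr_ge0 ler0n.
Qed.

(** * Motifs and their vectors *)

Section Motifs.
Variables (R : realType) (p L : nat) (pi : 'I_p -> {set {set 'I_L}}).
Variable s : 'I_L -> 'I_p.
Hypothesis pi_part : forall m, partition (pi m) [set: 'I_L].
Hypothesis piP : forall i m, ([set i]%SET \in pi m) = (m == s i).

Local Notation point := 'rV[R]_p.
Local Notation tuple := {ffun 'I_L -> 'rV[R]_p}.
Implicit Types (v : {ffun block pi -> R}) (S : {fset point}) (f : 'I_L -> point).

Lemma mem_cover_pi m i : i \in cover (pi m).
Proof. by rewrite (cover_partition (pi_part m)) inE. Qed.

Lemma block_ex m i : m != s i ->
  exists2 b : block pi, (val b).1 = m & i \in (val b).2.
Proof.
move=> msi; have Bi := mem_cover_pi m i.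
have bP : (pblock (pi m) i \in pi m) && (#|pblock (pi m) i| != 1%N).
  rewrite pblock_mem //=; apply: contraNneq msi => /eqP/cards1P[j e].
  have : i \in pblock (pi m) i by rewrite mem_pblock.
  by rewrite e inE -piP => /eqP ->; rewrite -e pblock_mem.
by exists (exist _ (m, pblock (pi m) i) bP) => //=; rewrite mem_pblock.
Qed.

Lemma block_star (b : block pi) i : i \in (val b).2 -> (val b).1 != s i.
Proof.
case: b => -[m B] /= /andP[Bm B1] iB; rewrite -piP.
apply: contra B1 => im; have tI := partition_trivIset (pi_part m).
rewrite -(def_pblock tI Bm iB) (def_pblock tI im (set11 i)).
by rewrite cards1.
Qed.

Lemma block_other (b : block pi) i0 : exists2 i, i \in (val b).2 & i != i0.
Proof.
case: b => -[m B] /= /andP[Bm B1].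
have B0 : B != set0.
  by apply: contraTneq Bm => ->; rewrite (partition0 (pi_part m)).
have : (1 < #|B|)%N.
  by rewrite ltn_neqAle eq_sym B1 card_gt0.
move=> /card_gt1P[x [y [xB yB xy]]].
by case: (eqVneq x i0) => [e|]; [exists y; rewrite // -e eq_sym | exists x].
Qed.

Lemma fvec_star v i : fvec v i (s i) = None.
Proof. by rewrite /fvec piP eqxx. Qed.

Lemma fvec_block v (b : block pi) i :
  i \in (val b).2 -> fvec v i (val b).1 = Some (v b).
Proof.
move=> ib; rewrite /fvec piP (negPf (block_star ib)).
have -> : ((val b).1, pblock (pi (val b).1) i) = val b.
  case: b ib => -[m B] /= /andP[Bm B1] iB.
  by rewrite (def_pblock (partition_trivIset (pi_part m)) Bm iB).
by rewrite valK.
Qed.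

Lemma agreesP v i (x : point) :
  reflect (forall b : block pi, i \in (val b).2 -> x 0 (val b).1 = v b)
    (agrees (fvec v i) x).
Proof.
apply: (iffP forallP) => [h b ib|h m].
  by have := h (val b).1; rewrite (fvec_block v ib) => /eqP.
have [->|/block_ex[b bm ib]] := eqVneq m (s i); first by rewrite fvec_star.
by rewrite -bm (fvec_block v ib) h.
Qed.

Lemma motifP f :
  reflect (forall b : block pi, {in (val b).2 &, forall i j, f i 0 (val b).1 = f j 0 (val b).1})
    (is_motif pi f).
Proof.
apply: (iffP forallP) => [h [[m B] /= /andP[Bm _]] i j iB jB|h m].
  have /forallP/(_ B)/implyP/(_ Bm)/forallP/(_ i)/implyP/(_ iB) := h m.
  by move=> /forallP/(_ j)/implyP/(_ jB)/eqP.
apply/forallP => B; apply/implyP => Bm; apply/forallP => i; apply/implyP => iB.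
apply/forallP => j; apply/implyP => jB.
have [/cards1P[k e]|B1] := boolP (#|B| == 1%N).
  by move: iB jB; rewrite e !inE => /eqP -> /eqP ->.
have bP : (B \in pi m) && (#|B| != 1%N) by rewrite Bm.
by apply/eqP/(h (exist _ (m, B) bP)).
Qed.

Lemma eq_is_motif f (g : 'I_L -> point) : f =1 g -> is_motif pi f = is_motif pi g.
Proof.
by move=> e; apply/motifP/motifP => h b i j ib jb; [rewrite -!e | rewrite !e]; apply: h.
Qed.

Lemma agrees_motif v f : (forall i, agrees (fvec v i) (f i)) -> is_motif pi f.
Proof.
move=> h; apply/motifP => b i j ib jb.
by rewrite (agreesP _ _ _ (h i)) // (agreesP _ _ _ (h j)).
Qed.

(** For a motif the choice of [i] in the block is immaterial; the default 0 is not reached, since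
    blocks of a partition are nonempty. *)
Definition motif_vec f : {ffun block pi -> R} :=
  [ffun b : block pi => (if [pick i in (val b).2] is Some i then f i 0 (val b).1 else 0) : R].

Lemma motif_vecE f (b : block pi) i :
  is_motif pi f -> i \in (val b).2 -> motif_vec f b = f i 0 (val b).1.
Proof.
move=> /motifP mf ib; rewrite ffunE; case: pickP => [j jb|/(_ i)]; last by rewrite ib.
exact: mf.
Qed.

Lemma agrees_motif_vec f i : is_motif pi f -> agrees (fvec (motif_vec f) i) (f i).
Proof. by move=> mf; apply/agreesP => b ib; rewrite (motif_vecE mf ib). Qed.

(* A non-singleton block meets the complement of {i0}, so all but one of the
   points of a motif already determine its vector. *)
Lemma motif_vec_determined v f i0 : is_motif pi f ->
  (forall i, i != i0 -> agrees (fvec v i) (f i)) -> motif_vec f = v.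
Proof.
move=> mf h; apply/ffunP => b; have [i ib ii0] := block_other b i0.
by rewrite (motif_vecE mf ib) (agreesP _ _ _ (h i ii0)).
Qed.

(** Replacing the star by 0 normalizes the base point, so that equal lines have equal base
    points. *)
Definition line_base v i : point := \row_m odflt 0 (fvec v i m).

Lemma agreesE v i x : agrees (fvec v i) x = on_line (s i) (line_base v i) x.
Proof.
apply: eq_forallb => m; have [->|/block_ex[b bm ib]] /= := eqVneq m (s i).
  by rewrite fvec_star.
by rewrite mxE -bm (fvec_block v ib).
Qed.

Lemma agrees_line v i x y : agrees (fvec v i) x -> agrees (fvec v i) y = on_line (s i) x y.
Proof.
rewrite !agreesE => /on_lineP h; apply: eq_forallb => m.
by case: eqVneq => //= /h ->.
Qed.

Lemma agree_countE S (P : 'I_p -> option R) :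
  agree_count S P = #|[set x : S | agrees P (val x)]%SET|.
Proof. exact: card_fset_pred. Qed.

Definition motifs S : {fset tuple} := [fset f in tuples 'I_L S | is_motif pi f].

Lemma motif_countE S : motif_count pi S = #|` motifs S|.
Proof.
rewrite /motifs card_tuples; congr #|pred_of_set _|; apply/setP => f.
by rewrite !inE; apply: eq_is_motif => i; rewrite ffunE.
Qed.

Lemma in_motifs S (f : tuple) : (f \in motifs S) = [forall i, f i \in S] && is_motif pi f.
Proof. by rewrite !inE in_tuples. Qed.

End Motifs.

(** * Counting motifs *)

Lemma leq_exp2rW m n e : (m <= n -> m ^ e <= n ^ e)%N.
Proof. by case: e => // e; rewrite leq_exp2r. Qed.

Section Counting.
Variables (R : realType) (p L : nat) (pi : 'I_p -> {set {set 'I_L}}).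
Variable s : 'I_L -> 'I_p.
Hypothesis pi_part : forall m, partition (pi m) [set: 'I_L].
Hypothesis piP : forall i m, ([set i]%SET \in pi m) = (m == s i).

Local Notation point := 'rV[R]_p.
Local Notation tuple := {ffun 'I_L -> 'rV[R]_p}.
Implicit Types (v : {ffun block pi -> R}) (S : {fset point}).

Lemma agree_count_line S v i x :
  agrees (fvec v i) x -> agree_count S (fvec v i) = line_count S (s i) x.
Proof.
move=> vx; rewrite agree_countE; apply: eq_card => y.
by rewrite !inE (agrees_line pi_part piP _ vx).
Qed.

(** Once the other points of a motif are fixed, so is its vector, and the [i0]-th point stays on one
    line of at most [#|S| / K] points. The sets [F i] allow a further point to be prescribed. *)
Lemma card_light_motifs S (F : 'I_L -> {set S}) i0 K (A : {set {ffun 'I_L -> S}}) :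
  (forall f, f \in A -> [/\ is_motif pi (fun i => val (f i)),
     (K * line_count S (s i0) (val (f i0)) <= #|` S|)%N & forall i, f i \in F i]) ->
  (K * #|A| <= #|` S| * \prod_(i | i != i0) #|F i|)%N.
Proof.
move=> AP; apply: leq_card_fibers => [f i /AP[]//|f fA].
have [mf lf _] := AP f fA; apply: leq_trans lf; rewrite leq_mul2l; apply/orP; right.
rewrite -(card_in_imset (f := fun g : {ffun 'I_L -> S} => g i0)); last first.
  move=> g h; rewrite !inE => /andP[_ /forallP ge] /andP[_ /forallP he] e.
  apply/ffunP => i; have [->//|ii0] := eqVneq i i0.
  by rewrite (eqP (implyP (ge i) ii0)) (eqP (implyP (he i) ii0)).
apply/subset_leq_card/subsetP => _ /imsetP[g + ->]; rewrite !inE => /andP[gA /forallP ge].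
have [mg _ _] := AP g gA.
have fv i := agrees_motif_vec pi_part piP i mf.
rewrite -(agrees_line pi_part piP _ (fv i0)).
rewrite -(motif_vec_determined (i0 := i0) pi_part piP mg (v := motif_vec pi (fun i => val (f i)))).
  exact: (agrees_motif_vec pi_part piP i0 mg).
by move=> i ii0; rewrite (eqP (implyP (ge i) ii0)).
Qed.

Lemma card_motif_light S K :
  (K * #|[set f : {ffun 'I_L -> S} | is_motif pi (fun i => val (f i)) &&
                [exists i, f i \notin heavy S K (s i)]]%SET| <= L * #|` S| ^ L)%N.
Proof.
pose light i := [set f : {ffun 'I_L -> S} |
  is_motif pi (fun i => val (f i)) && (f i \notin heavy S K (s i))]%SET.
have lightP i : (K * #|light i| <= #|` S| ^ L)%N.
  rewrite cardfE -(prod_card_const _ i) -cardfE.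
  apply: card_light_motifs => f; rewrite !inE => /andP[mf].
  by rewrite -ltnNge => /ltnW lf; split => // j; rewrite inE.
apply: leq_trans (_ : K * \sum_i #|light i| <= _)%N.
  rewrite leq_mul2l; apply/orP; right; apply: leq_card_cover_family => f.
  by rewrite in_set => /andP[mf /existsP[i fi]]; exists i; rewrite in_set mf.
rewrite big_distrr /=; apply: leq_trans (leq_sum _ (fun i _ => lightP i)) _.
by rewrite sum_nat_const card_ord.
Qed.

(** Motifs made of heavy points and the non-motifs in [B] are disjoint parts of the product of the
    heavy sets; all other motifs have a light point. Carrying [B] along is what later gives
    stability. *)
Lemma motif_heavy_bound S K (B : {set {ffun 'I_L -> S}}) :
  (forall f, f \in B -> ~~ is_motif pi (fun i => val (f i))) ->
  (forall f i, f \in B -> f i \in heavy S K (s i)) ->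
  (K * (motif_count pi S + #|B|) <= L * #|` S| ^ L + K * \prod_i #|heavy S K (s i)|)%N.
Proof.
move=> Bnm Bh; rewrite /motif_count; set A := [set f | _]%SET.
pose H := [set f : {ffun 'I_L -> S} | [forall i, f i \in heavy S K (s i)]]%SET.
have AB : (#|A :&: H|%SET + #|B| <= #|H|)%N.
  rewrite -cardsUI (_ : #|(A :&: H) :&: B|%SET = 0%N) ?addn0; last first.
    apply/eqP; rewrite cards_eq0; apply/eqP/setP => f; rewrite !inE.
    by apply/negP => /andP[/andP[mf _] /Bnm]; rewrite mf.
  apply/subset_leq_card/subsetP => f; rewrite !inE => /orP[/andP[]//|fB].
  by apply/forallP => i; apply: Bh.
rewrite -card_set_family -/H -(cardsID H A) addnAC addnC mulnDr leq_add ?leq_mul2l ?AB ?orbT //.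
apply: leq_trans (card_motif_light S K); rewrite leq_mul2l; apply/orP; right.
apply/subset_leq_card/subsetP => f; rewrite in_setD !in_set negb_forall.
by move=> /andP[-> ->].
Qed.

(** The numerator of the constant: [C_j] contributes a factor [alpha_j] for each of its [alpha_j]
    indices. *)
Definition star_weight := (\prod_i #|[set j | s j == s i]%SET|)%N.

Lemma motif_count_ub S K (B : {set {ffun 'I_L -> S}}) :
  (forall f, f \in B -> ~~ is_motif pi (fun i => val (f i))) ->
  (forall f i, f \in B -> f i \in heavy S K (s i)) ->
  (L ^ L * (K * (motif_count pi S + #|B|)) <=
   L ^ L * (L * #|` S| ^ L) + K * (star_weight * (#|` S| + p * p * K ^ 2) ^ L))%N.
Proof.
move=> Bnm Bh; apply: leq_trans (leq_mul (leqnn _) (motif_heavy_bound Bnm Bh)) _.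
rewrite mulnDr leq_add2l mulnCA leq_mul2l; apply/orP; right.
have := prod_AGM s (fun m => #|heavy S K m|); rewrite card_ord => /leq_trans; apply.
by rewrite leq_mul2l; apply/orP; right; apply/leq_exp2rW/sum_card_heavy.
Qed.

Lemma single_blocksE m : #|singleton_blocks pi m| = #|[set i | s i == m]%SET|.
Proof.
rewrite -(card_imset _ (@set1_inj 'I_L)); apply: eq_card => B; rewrite !inE.
apply/andP/imsetP => [[Bm /cards1P[i e]]|[i]].
  by exists i => //; rewrite inE eq_sym -piP -e.
by rewrite inE eq_sym -piP => im ->; rewrite cards1.
Qed.

Lemma starredE m : (m \in starred pi) = [exists i, s i == m].
Proof.
rewrite inE -cards_eq0 single_blocksE cards_eq0.
by apply/set0Pn/existsP => -[i]; rewrite ?inE => h; exists i; rewrite ?inE.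
Qed.

Lemma motif_constE : motif_const R pi = star_weight%:R / (L ^ L)%N%:R.
Proof.
congr (_%:R / _); rewrite /star_weight (partition_big s predT) //= big_mkcond /=.
apply: eq_bigr => m _; rewrite single_blocksE.
rewrite [RHS](eq_bigr (fun=> #|[set j | s j == m]%SET|)); last by move=> i /eqP ->.
rewrite prod_nat_const.
have -> : #|[pred i | s i == m]| = #|[set j | s j == m]%SET| by apply: eq_card => i; rewrite !inE.
case: ifP => //; rewrite starredE => /existsP no.
rewrite (_ : [set j | s j == m]%SET = set0) ?cards0 //.
by apply/setP => j; rewrite !inE; apply/negP => jm; case: no; exists j.
Qed.

End Counting.

(** * Lower bounds and existence of the maximum *)

Section Constructions.
Variables (R : realType) (p L : nat) (pi : 'I_p -> {set {set 'I_L}}).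
Variable s : 'I_L -> 'I_p.
Hypothesis pi_part : forall m, partition (pi m) [set: 'I_L].
Hypothesis piP : forall i m, ([set i]%SET \in pi m) = (m == s i).

Local Notation point := 'rV[R]_p.
Implicit Types (v : {ffun block pi -> R}) (S : {fset point}).

(** A source of new points: any point whose [m]-th coordinate is [t] lies outside [S]. *)
Lemma coord_ub S m : exists t : R, forall x, x \in S -> x 0 m < t.
Proof.
exists (1 + \sum_(x : S) `|val x 0 m|) => x xS.
rewrite (bigD1 [` xS]) //= -[ltLHS]add0r ltr_leD // (le_trans (ler_norm _)) //.
by rewrite lerDl sumr_ge0.
Qed.

Lemma extend_fset S r (m : 'I_p) : (#|` S| <= r)%N ->
  exists2 S', S `<=` S' & #|` S'| = r.
Proof.
elim: r => [|r IH]; first by rewrite leqn0 => /eqP S0; exists S.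
rewrite leq_eqVlt => /orP[/eqP e|]; first by exists S.
rewrite ltnS => /IH[S' SS' S'r]; have [t tP] := coord_ub S' m.
exists (const_mx t |` S'); first exact: fsubset_trans SS' (fsubsetU1 _ _).
rewrite cardfsU1 S'r (_ : const_mx t \notin S') //.
by apply/negP => /tP; rewrite mxE ltxx.
Qed.

Lemma motif_count_ge_agree S v :
  (\prod_i agree_count S (fvec v i) <= motif_count pi S)%N.
Proof.
rewrite motif_countE (eq_bigr _ (fun i _ => agree_countE S (fvec v i))).
rewrite -(card_tuples_family S (fun i => agrees (fvec v i))); apply/fsubset_leq_card/fsubsetP => f.
rewrite !inE => /andP[-> /forallP h] /=.
exact: (agrees_motif pi_part piP h).
Qed.

Lemma motif_count_le S : (motif_count pi S <= #|` S| ^ L)%N.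
Proof. by rewrite (leq_trans (max_card _)) // card_ffun card_ord -cardfE. Qed.

(* Spread about r * alpha_m / L points over the m-th coordinate axis. *)
Lemma motif_count_lb r : (0 < L)%N -> exists2 S : {fset point},
  #|` S| = r & (star_weight s * (r %/ L) ^ L <= motif_count pi S)%N.
Proof.
move=> L_gt0; set n := (r %/ L)%N.
(* Distinct pairs give distinct scalars, and the successor keeps them nonzero, so points on
   different axes differ too. *)
pose pt (z : 'I_L * 'I_n) : point := (z.1 * n + z.2).+1%:R *: delta_mx 0 (s z.1).
have pt_inj : injective pt.
  move=> [i t] [i' t'] /rowP/(_ (s i)); rewrite !mxE !eqxx /= mulr1.
  case: eqVneq => _; last by move=> /eqP; rewrite mulr0 pnatr_eq0.
  rewrite mulr1 => /eqP; rewrite eqr_nat eqSS => /eqP e.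
  have n_gt0 : (0 < n)%N by apply: leq_ltn_trans (ltn_ord t).
  congr (_, _); apply: val_inj => /=.
    have := congr1 (divn^~ n) e.
    by rewrite /= !divnMDl // !divn_small ?addn0.
  by have := congr1 (modn^~ n) e; rewrite /= !modnMDl !modn_small.
pose S0 : {fset point} := [fset pt z | z in [set: 'I_L * 'I_n]%SET].
have S0r : (#|` S0| <= r)%N.
  rewrite card_inj_imfset // cardsT card_prod !card_ord mulnC; exact: leq_trunc_div.
have [S S0S Sr] := extend_fset (s (Ordinal L_gt0)) S0r.
(* The lines of the zero vector are the coordinate axes; axis [m] carries [n] points for every [j]
   with [s j = m]. *)
exists S => //; apply: leq_trans (motif_count_ge_agree S [ffun=> 0]).
rewrite -[X in (_ ^ X)%N]card_ord -prod_nat_const -big_split.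
apply: leq_prod => i _ /=.
rewrite -[n in (_ * n)%N]card_ord -[X in (_ * X)%N]cardsT -cardsX.
rewrite -(card_inj_imfset _ pt_inj); apply/fsubset_leq_card/fsubsetP => x.
case/imfsetP => -[j t] /=; rewrite !inE andbT /= => sj ->.
rewrite (fsubsetP S0S) ?in_imfset ?inE //=.
apply/(agreesP pi_part piP) => b ib; rewrite !mxE ffunE /=.
by rewrite (eqP sj) (negPf (block_star pi_part piP ib)) mulr0.
Qed.

Lemma max_motif_count_ex r : (0 < L)%N -> exists n, is_max_motif_count R pi r n.
Proof.
move=> L_gt0.
pose P n := boolp.asbool (exists S, #|` S| = r /\ motif_count pi S = n).
have exP : exists n, P n.
  have [S Sr _] := motif_count_lb r L_gt0.
  by exists (motif_count pi S); apply/boolp.asboolP; exists S.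
have ubP n : P n -> (n <= r ^ L)%N.
  by move=> /boolp.asboolP[S [<- <-]]; apply: motif_count_le.
case: (ex_maxnP exP ubP) => n /boolp.asboolP[S [Sr Sn]] nmax.
exists n; split; first by exists S.
by move=> S' S'r; apply/nmax/boolp.asboolP; exists S'.
Qed.

End Constructions.

(** * Stability of maximal sets *)

Section Asymptotics.
Variable R : realType.

(** By convexity, the graph of [(1 + x) ^+ n] lies below its chord over the interval from 0 to 1. *)
Lemma exprD1_le (x : R) n : 0 <= x <= 1 -> (1 + x) ^+ n <= 1 + (2 ^+ n - 1) * x.
Proof.
move=> /andP[x0 x1]; elim: n => [|n IH]; first by rewrite !expr0 subrr mul0r addr0.
have t1 : 1 <= 2 ^+ n :> R by apply: exprn_ege1; rewrite ler1n.
rewrite exprS; apply: le_trans (ler_wpM2l _ IH) _; first lra.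
rewrite [2 ^+ n.+1]exprS.
(* This product is exactly the slack in the induction step. *)
have : 0 <= (2 ^+ n - 1) * (x * (1 - x)) by rewrite !mulr_ge0 ?subr_ge0.
lra.
Qed.

Lemma nat_ub (x : R) : exists n : nat, x <= n%:R.
Proof.
exists (Num.truncn x).+1; have [x0|x0] := leP 0 x; first by rewrite ltW // truncnS_gt.
by rewrite (le_trans (ltW x0)).
Qed.

Lemma expr_shift_le (K L : nat) (e : R) : 0 < e ->
  exists r0 : nat, forall r : nat, (r0 <= r)%N ->
    (r + K)%:R ^+ L <= (1 + e) * r%:R ^+ L.
Proof.
(* The bound [r >= n] makes the chord's error at [K / r] at most [e], and [r > K] keeps [K / r]
   below 1. *)
move=> e0; have [n nP] := nat_ub (2 ^+ L * K%:R / e).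
exists (maxn n K.+1) => r; rewrite geq_max => /andP[nr Kr].
have r0 : 0 < r%:R :> R by rewrite ltr0n (leq_trans _ Kr).
have -> : (r + K)%:R = r%:R * (1 + K%:R / r%:R) :> R.
  by rewrite natrD mulrDr mulr1 mulrC divfK // gt_eqF.
rewrite exprMn mulrC ler_wpM2r ?exprn_ge0 ?ler0n //.
apply: le_trans (exprD1_le _ _) _.
  by rewrite divr_ge0 ?ler0n //= ler_pdivrMr // mul1r ler_nat ltnW.
rewrite lerD2l mulrA ler_pdivrMr //.
have : 2 ^+ L * K%:R / e <= r%:R by rewrite (le_trans nP) // ler_nat.
rewrite ler_pdivrMr // [_ * e]mulrC; apply: le_trans.
by rewrite ler_wpM2r ?ler0n // lerBlDr lerDl.
Qed.

(** With [N = L * (r %/ L)] one has [r <= N + L], so the previous bound applies at [N], and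
    [(1 - e) * (1 + e) <= 1]. *)
Lemma expr_floor_ge (L : nat) (e : R) : (0 < L)%N -> 0 < e ->
  exists r0 : nat, forall r : nat, (r0 <= r)%N ->
    (1 - e) * r%:R ^+ L <= (L * (r %/ L))%N%:R ^+ L.
Proof.
move=> L_gt0 e0; have [r1 r1P] := expr_shift_le L L e0.
exists (r1 + L)%N => r r1r; set N := (L * (r %/ L))%N.
have rN : (r <= N + L)%N.
  by rewrite {1}(divn_eq r L) mulnC leq_add2l ltnW // ltn_pmod.
have r1N : (r1 <= N)%N by rewrite -(leq_add2r L) (leq_trans r1r).
have [e1|e1] := leP e 1; last first.
  by apply: (@le_trans _ _ 0); rewrite ?exprn_ge0 ?ler0n // mulr_le0_ge0 ?exprn_ge0 ?ler0n //; lra.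
have h : r%:R ^+ L <= (1 + e) * N%:R ^+ L.
  by apply: le_trans (r1P N r1N); rewrite lerXn2r ?nnegrE ?ler0n // ler_nat.
have N0 : 0 <= N%:R ^+ L :> R by rewrite exprn_ge0 ?ler0n.
apply: le_trans (ler_wpM2l _ h) _; first lra.
have -> : (1 - e) * ((1 + e) * N%:R ^+ L) = N%:R ^+ L - e ^+ 2 * N%:R ^+ L by ring.
by rewrite lerBlDr lerDl mulr_ge0 // exprn_ge0 // ltW.
Qed.

End Asymptotics.

Section Stability.
Variables (R : realType) (p L : nat) (pi : 'I_p -> {set {set 'I_L}}).
Variable s : 'I_L -> 'I_p.
Hypothesis pi_part : forall m, partition (pi m) [set: 'I_L].
Hypothesis piP : forall i m, ([set i]%SET \in pi m) = (m == s i).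
Hypothesis L_gt0 : (0 < L)%N.

Local Notation point := 'rV[R]_p.
Local Notation C := (motif_const R pi).
Implicit Types (v : {ffun block pi -> R}) (S : {fset point}).

Lemma motif_const_ge : ((L ^ L)%N%:R)^-1 <= C.
Proof.
rewrite (motif_constE R piP) -[leLHS]mul1r ler_wpM2r ?invr_ge0 ?ler0n //.
rewrite ler1n prodn_gt0 // => i; rewrite card_gt0.
by apply/set0Pn; exists i; rewrite inE.
Qed.

Lemma motif_const_gt0 : 0 < C.
Proof. by apply: lt_le_trans motif_const_ge; rewrite invr_gt0 ltr0n expn_gt0 L_gt0. Qed.

Lemma motif_count_max_ge (e : R) : 0 < e -> exists r0 : nat, forall r n : nat,
  (r0 <= r)%N -> is_max_motif_count R pi r n -> (C - e) * r%:R ^+ L <= n%:R.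
Proof.
move=> e0; have eC : 0 < e / C by rewrite divr_gt0 ?motif_const_gt0.
have [r0 r0P] := expr_floor_ge L_gt0 eC; exists r0 => r n rr0 [_ nmax].
have [S Sr SW] := motif_count_lb R pi_part piP r L_gt0.
have LL : (L ^ L)%N%:R != 0 :> R by rewrite pnatr_eq0 -lt0n expn_gt0 L_gt0.
apply: (@le_trans _ _ (star_weight s * (r %/ L) ^ L)%N%:R); last first.
  by rewrite ler_nat (leq_trans SW) // nmax.
have -> : (star_weight s * (r %/ L) ^ L)%N%:R = C * (L * (r %/ L))%N%:R ^+ L :> R.
  by rewrite (motif_constE R piP) -natrX expnMn !natrM [RHS]mulrA divfK.
have -> : C - e = C * (1 - e / C).
  by rewrite mulrBr mulr1 mulrC divfK // gt_eqF ?motif_const_gt0.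
by rewrite -mulrA ler_wpM2l ?r0P // ltW ?motif_const_gt0.
Qed.

(** [K] is chosen first, with [L / K <= e / 2], to absorb the light motifs; then [r] is taken so
    large that the overlaps of heavy sets cost another [e / 2]. Having [K >= K0] makes lines with
    [#|S| / K0] points heavy. *)
Lemma motif_count_add_le (e : R) (K0 : nat) : 0 < e ->
  exists K r0 : nat, (K0 <= K)%N /\
  forall S (B : {set {ffun 'I_L -> S}}), (r0 <= #|` S|)%N ->
    (forall f, f \in B -> ~~ is_motif pi (fun i => val (f i))) ->
    (forall f i, f \in B -> f i \in heavy S K (s i)) ->
    (motif_count pi S + #|B|)%N%:R <= (C + e) * #|` S|%:R ^+ L.
Proof.
move=> e0; have [n nP] := nat_ub (2 * L%:R / e).
pose K := (maxn n K0.+1); have K_gt0 : 0 < K%:R :> R by rewrite ltr0n leq_max orbT.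
have eC : 0 < e / (2 * C) by rewrite divr_gt0 // mulr_gt0 ?ltr0n // motif_const_gt0.
have [r0 r0P] := expr_shift_le (p * p * K ^ 2) L eC.
exists K, r0; split; first by rewrite leq_max leqnSn orbT.
move=> S B r0S Bnm Bh.
have LL : 0 < (L ^ L)%N%:R :> R by rewrite ltr0n expn_gt0 L_gt0.
have := motif_count_ub pi_part piP Bnm Bh.
rewrite -(ler_nat R) [in X in _ <= X]natrD ![in X in X <= _](natrM R).
set N := (motif_count pi S + #|B|)%N%:R; set r := #|` S|.
have -> : (L ^ L * (L * r ^ L))%N%:R = (L ^ L)%N%:R * (L%:R * r%:R ^+ L) :> R.
  by rewrite !natrM [(r ^ L)%N%:R]natrX.
have -> : (K * (star_weight s * (r + p * p * K ^ 2) ^ L))%N%:R =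
          (L ^ L)%N%:R * (K%:R * (C * (r + p * p * K ^ 2)%N%:R ^+ L)) :> R.
  rewrite (motif_constE R piP) 2!natrM [((r + _) ^ L)%N%:R]natrX.
  by rewrite [RHS]mulrCA; congr (_ * _); rewrite mulrA mulrCA divff ?mulr1 ?gt_eqF.
rewrite -mulrDr ler_pM2l // => h.
have KL : L%:R <= K%:R * (e / 2) :> R.
  have : 2 * L%:R / e <= K%:R by rewrite (le_trans nP) // ler_nat leq_maxl.
  by rewrite ler_pdivrMr // => h'; lra.
have rL0 : 0 <= r%:R ^+ L :> R by rewrite exprn_ge0 ?ler0n.
rewrite -(ler_pM2l K_gt0); apply: le_trans h _.
have -> : K%:R * ((C + e) * r%:R ^+ L) =
  K%:R * (e / 2) * r%:R ^+ L + K%:R * (C * ((1 + e / (2 * C)) * r%:R ^+ L)) :> R.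
  by field; rewrite gt_eqF ?motif_const_gt0.
apply: lerD; first by rewrite ler_wpM2r.
by rewrite ler_wpM2l ?(ltW K_gt0) // ler_wpM2l ?(ltW motif_const_gt0) // r0P.
Qed.

(** Otherwise the tuples on these lines, at least [e * r^L] of them with [e = k^(-L)], are all heavy
    non-motifs. Added to the at least [(C - e/4) * r^L] motifs, they exceed the bound
    [(C + e/4) * r^L]. *)
Lemma on_lines_motif (k : nat) : (0 < k)%N -> exists r0 : nat,
  forall S, (r0 <= #|` S|)%N -> is_max_motif_count R pi #|` S| (motif_count pi S) ->
  forall c : 'I_L -> point,
    (forall i, #|` S| <= k * line_count S (s i) (c i))%N ->
  exists2 f : 'I_L -> point, (forall i, on_line (s i) (c i) (f i)) & is_motif pi f.
Proof.
move=> k_gt0; pose e : R := ((k ^ L)%N%:R)^-1.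
have e0 : 0 < e by rewrite invr_gt0 ltr0n expn_gt0 k_gt0.
have e4 : 0 < e / 4 by lra.
have [r1 r1P] := motif_count_max_ge e4.
have [K [r2 [kK r2P]]] := motif_count_add_le k e4.
exists (maxn 1 (maxn r1 r2)) => S; rewrite !geq_max => /and3P[r0 rr1 rr2] maxS c ck.
pose B := [set f : {ffun 'I_L -> S} | [forall i, f i \in [set x | on_line (s i) (c i) (val x)]%SET]]%SET.
have [/existsP[f /andP[fB mf]]|noB] := boolP [exists f, (f \in B) && is_motif pi (fun i => val (f i))].
  by exists (fun i => val (f i)) => // i; move: fB; rewrite inE => /forallP/(_ i); rewrite inE.
have Bnm f : f \in B -> ~~ is_motif pi (fun i => val (f i)).
  by move=> fB; apply: contra noB => mf; apply/existsP; exists f; rewrite fB.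
have Bh f i : f \in B -> f i \in heavy S K (s i).
  rewrite inE => /forallP/(_ i); rewrite inE => fi.
  by rewrite inE (line_count_base _ fi) (leq_trans (ck i)) // leq_mul2r kK orbT.
have Bge : #|` S|%:R ^+ L * e <= #|B|%:R.
  rewrite ler_pdivrMr ?ltr0n ?expn_gt0 ?k_gt0 // -natrX -natrM ler_nat card_set_family.
  have PE q : (q ^ L = \prod_(i < L) q)%N by rewrite prod_nat_const card_ord.
  rewrite !PE -big_split /=.
  by apply: leq_prod => i _; rewrite mulnC; exact: ck.
have := r2P S B rr2 Bnm Bh; have := r1P _ _ rr1 maxS; rewrite natrD.
have : 0 < #|` S|%:R ^+ L * e by rewrite mulr_gt0 // exprn_gt0 // ltr0n.
by move: Bge; lra.
Qed.
End Stability.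

(** * Centers *)

Section Centers.
Variables (R : realType) (p L : nat) (pi : 'I_p -> {set {set 'I_L}}).
Variable s : 'I_L -> 'I_p.
Hypothesis pi_part : forall m, partition (pi m) [set: 'I_L].
Hypothesis piP : forall i m, ([set i]%SET \in pi m) = (m == s i).
Hypothesis L_gt0 : (0 < L)%N.

Local Notation point := 'rV[R]_p.
Implicit Types (u v : {ffun block pi -> R}) (S : {fset point}).

Let maximal S := is_max_motif_count R pi #|` S| (motif_count pi S).

Lemma M1_gt0 : (0 < M1 L)%N.
Proof. by rewrite muln_gt0 L_gt0 addn1. Qed.

Lemma leq_M1_M : (M1 L <= M L)%N.
Proof.
have [L1|L1] := leqP L 1; first by have -> : L = 1%N by apply/eqP; rewrite eqn_leq L1.
have M2 : (0 < 2 * M1 L)%N by rewrite muln_gt0 M1_gt0.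
have Lsq : (0 < L ^ 2)%N by rewrite expn_gt0 L_gt0.
apply: leq_trans (leq_addr _ _); apply: leq_trans (leq_pmulr _ Lsq).
apply: (@leq_trans (2 * M1 L)); first exact: leq_pmull.
by rewrite -{1}[(2 * M1 L)%N]expn1 leq_pexp2l // subn_gt0.
Qed.

Lemma natr_ratio_le (k r n : nat) : (0 < k)%N -> (r%:R / k%:R <= n%:R :> R) = (r <= k * n)%N.
Proof. by move=> k0; rewrite ler_pdivrMr ?ltr0n // -natrM ler_nat mulnC. Qed.

Lemma M_gt0 : (0 < M L)%N.
Proof. by rewrite /M addn1. Qed.

Lemma hypercenterP S v :
  is_hypercenter S v <-> forall i, (#|` S| <= M1 L * agree_count S (fvec v i))%N.
Proof. by split => h i; have := h i; rewrite natr_ratio_le ?M1_gt0. Qed.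

Lemma centerP S v : is_center S v <->
  forall i j, i != j -> (#|` S| <= M L * agree_count S (fvec v i))%N \/
                        (#|` S| <= M L * agree_count S (fvec v j))%N.
Proof.
rewrite /is_center; set G := [set i | _]%SET.
have inG i : (i \in G) = (#|` S| <= M L * agree_count S (fvec v i))%N.
  by rewrite inE natr_ratio_le ?M_gt0.
have -> : (L - 1 <= #|G|)%N = (#|~: G|%SET <= 1)%N.
  by have := cardsC G; rewrite card_ord; lia.
split=> [/card_le1_eqP h i j ij|h].
  rewrite -!inG; apply/orP; apply: contraT; rewrite negb_or => /andP[iG jG].
  by have := h i j; rewrite !in_setC => e; rewrite (e iG jG) eqxx in ij.
apply/card_le1_eqP => i j; rewrite !in_setC => iG jG.
apply/eqP; apply: contraT => /h; rewrite -!inG (negPf iG) (negPf jG).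
by case.
Qed.

Lemma agree_count_base S v i :
  agree_count S (fvec v i) = line_count S (s i) (line_base v i).
Proof.
by rewrite agree_countE; apply: eq_card => x; rewrite !inE (agreesE pi_part piP).
Qed.

Lemma hypercenter_center S v : is_hypercenter S v -> is_center S v.
Proof.
move=> /hypercenterP h; apply/centerP => i j _; left.
by rewrite (leq_trans (h i)) // leq_mul2r leq_M1_M orbT.
Qed.

(** If every motif had a point on a line lighter than [r / M1 L], there would be at most
    [r^L / (L^L + 1)] motifs, while the maximum is about [C * r^L] and [C >= 1 / L^L]. *)
Lemma hypercenter_ex : exists r0 : nat, forall S,
  (r0 <= #|` S|)%N -> maximal S -> exists v, is_hypercenter S v.
Proof.
pose a : R := (L ^ L)%N%:R.
have a_gt0 : 0 < a by rewrite ltr0n expn_gt0 L_gt0.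
(* Half the gap between [1 / a] and [1 / (a + 1)]. *)
pose e : R := (a * (a + 1))^-1 / 2.
have e_gt0 : 0 < e by rewrite divr_gt0 // invr_gt0 mulr_gt0 // addr_gt0.
have [r0 r0P] := motif_count_max_ge pi_part piP L_gt0 e_gt0.
exists (maxn 1 r0) => S; rewrite geq_max => /andP[S_gt0 r0S] maxS.
have [/existsP[f /andP[mf /forallP fh]]|no] := boolP [exists f : {ffun 'I_L -> S},
    is_motif pi (fun i => val (f i)) && [forall i, f i \in heavy S (M1 L) (s i)]].
  exists (motif_vec pi (fun i => val (f i))); apply/hypercenterP => i.
  rewrite (agree_count_line pi_part piP _ (agrees_motif_vec pi_part piP i mf)).
  by have := fh i; rewrite inE.
have : (M1 L * motif_count pi S <= L * #|` S| ^ L)%N.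
  apply: leq_trans (card_motif_light pi_part piP S (M1 L)).
  rewrite leq_mul2l; apply/orP; right; apply/subset_leq_card/subsetP => f.
  rewrite !inE => mf; rewrite mf /= -negb_forall; apply: contra no => fh.
  by apply/existsP; exists f; rewrite mf.
rewrite /M1 -mulnA leq_pmul2l // -(ler_nat R) natrM natrD -/a natrX.
have := r0P _ _ r0S maxS; set N := (motif_count _ _)%:R; set X := _ ^+ L => NX NX'.
have X_gt0 : 0 < X by rewrite exprn_gt0 // ltr0n.
have : (a^-1 - e) * X <= N.
  apply: le_trans NX; rewrite ler_wpM2r ?(ltW X_gt0) // lerD2r.
  exact: motif_const_ge piP.
move=> h; have : (a + 1) * ((a^-1 - e) * X) <= X.
  by apply: le_trans NX'; rewrite ler_wpM2l // addr_ge0 ?ltW.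
have -> : (a + 1) * ((a^-1 - e) * X) = X + a^-1 / 2 * X.
  by rewrite /e; field; rewrite ?gt_eqF //; lra.
have : 0 < a^-1 / 2 * X by rewrite !mulr_gt0 // invr_gt0.
by lra.
Qed.

(* If c lay on another heavy line of direction s i, then no choice of points on
   that line and on the remaining lines of v would be a motif, while such tuples
   form a positive proportion of all tuples. *)
Lemma hypercenter_replace (k : nat) : (M1 L <= k)%N -> exists r0 : nat, forall S v i c,
  (r0 <= #|` S|)%N -> maximal S -> is_hypercenter S v ->
  (#|` S| <= k * line_count S (s i) c)%N -> on_line (s i) (line_base v i) c.
Proof.
move=> M1k; have k_gt0 : (0 < k)%N := leq_trans M1_gt0 M1k.
have [r0 r0P] := on_lines_motif R pi_part piP L_gt0 k_gt0.
exists r0 => S v i c r0S maxS /hypercenterP hv ck.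
have [j|f fc mf] := r0P S r0S maxS (fun j => if j == i then c else line_base v j).
  case: eqP => [->//|_]; rewrite -agree_count_base (leq_trans (hv j)) //.
  by rewrite leq_mul2r M1k orbT.
(* All points but the [i]-th lie on lines of [v], and they determine the vector. *)
have fv : motif_vec pi f = v.
  apply: (motif_vec_determined (i0 := i) pi_part piP mf) => j ji.
  by have := fc j; rewrite (negPf ji) (agreesE pi_part piP).
have := agrees_motif_vec pi_part piP i mf; rewrite fv (agreesE pi_part piP) => vf.
have := fc i; rewrite eqxx => /on_lineP cf; apply/on_lineP => m mi.
by rewrite -cf // (on_lineP _ _ _ vf).
Qed.

Lemma line_base_star v i : line_base v i 0 (s i) = 0.
Proof. by rewrite mxE (fvec_star piP). Qed.

Lemma line_base_block v (b : block pi) i :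
  i \in (val b).2 -> line_base v i 0 (val b).1 = v b.
Proof. by move=> ib; rewrite mxE (fvec_block pi_part piP v ib). Qed.

(** A non-singleton block has two indices, and at most one index is light for the center [u]. The
    line of [u] at the other one is heavy, hence is the line of [v] there, and both vectors take the
    same value on the block. *)
Lemma center_hypercenter_eq : exists r0 : nat, forall S u v,
  (r0 <= #|` S|)%N -> maximal S -> is_hypercenter S v -> is_center S u -> u = v.
Proof.
have [r0 r0P] := hypercenter_replace leq_M1_M.
exists r0 => S u v r0S maxS hv /centerP cu; apply/ffunP => b.
have [i0 i0b _] := block_other pi_part b (Ordinal L_gt0).
have [i1 i1b i10] := block_other pi_part b i0.
have key i : i \in (val b).2 -> (#|` S| <= M L * agree_count S (fvec u i))%N -> u b = v b.
  move=> ib; rewrite agree_count_base => /(r0P _ v _ _ r0S maxS hv)/on_lineP h.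
  by rewrite -!(line_base_block _ ib) h // (block_star pi_part piP ib).
by case: (cu _ _ i10); apply: key.
Qed.

Lemma hypercenter_line_eq : exists r0 : nat, forall S v i j,
  (r0 <= #|` S|)%N -> maximal S -> is_hypercenter S v -> s i = s j ->
  line_base v i = line_base v j.
Proof.
have [r0 r0P] := hypercenter_replace (leqnn (M1 L)).
exists r0 => S v i j r0S maxS hv sij; apply/rowP => m.
have [->|mi] := eqVneq m (s i); first by rewrite {2}sij !line_base_star.
apply/esym; move: m mi; apply/on_lineP; apply: (r0P S) => //.
by rewrite sij -agree_count_base; move/hypercenterP: hv.
Qed.

(** A motif with [x] at position [i] has a vector other than [v], so not a center; some index [j]
    other than [i] is then light. Each of the at most [L^2] pairs [(i, j)] accounts for at most
    [r^(L-1) / M L] motifs. *)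
Lemma card_motifs_through S v x : x \in S ->
  (forall u, is_center S u -> u = v) -> (forall i, ~~ agrees (fvec v i) x) ->
  (M L * #|` [fset f in motifs pi S | [exists i, f i == x]]| <= L ^ 2 * #|` S| ^ (L - 1))%N.
Proof.
move=> xS uniq_v nx; pose x' : S := [` xS].
pose A (z : 'I_L * 'I_L) := [set f : {ffun 'I_L -> S} | [&& is_motif pi (fun i => val (f i)),
   f z.1 == x', z.2 != z.1 & (M L * line_count S (s z.2) (val (f z.2)) <= #|` S|)%N]]%SET.
have Ale z : (M L * #|A z| <= #|` S| ^ (L - 1))%N.
  have [e|ne] := eqVneq z.2 z.1.
    rewrite (_ : A z = set0) ?cards0 ?muln0 //.
    by apply/setP => f; rewrite !inE e eqxx !andbF.
  pose F j := if j == z.1 then [set x']%SET else [set: S]%SET.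
  apply: leq_trans (_ : #|` S| * \prod_(i | i != z.2) #|F i| <= _)%N.
    apply: (card_light_motifs pi_part piP) => f; rewrite !inE => /and4P[mf fx _ lf].
    by split => // j; rewrite /F; case: eqP => [->|_]; rewrite inE.
  have -> : (#|` S| ^ (L - 1) = \prod_(j < L | j != z.1) #|` S|)%N.
    by rewrite prod_nat_const cardC1 card_ord subn1.
  rewrite (bigD1 z.1) 1?eq_sym //= [in leqRHS](bigD1 z.2) //=.
  rewrite {1}/F eqxx cards1 mul1n leq_mul2l; apply/orP; right.
  rewrite (eq_bigl _ _ (fun j => andbC _ _)); apply: leq_prod => j /andP[/negPf jz _].
  by rewrite /F jz cardsT cardfE.
apply: (@leq_trans (\sum_z M L * #|A z|)); last first.
  apply: leq_trans (leq_sum _ (fun z _ => Ale z)) _.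
  by rewrite sum_nat_const card_prod card_ord mulnn.
rewrite -big_distrr leq_mul2l; apply/orP; right.
have -> : [fset f in motifs pi S | [exists i, f i == x]] =
    [fset f in tuples 'I_L S | is_motif pi f && [exists i, f i == x]].
  by apply/fsetP => f; rewrite !inE andbA.
rewrite card_tuples; apply: leq_card_cover_family => f; rewrite inE.
rewrite (@eq_is_motif _ _ _ _ _ (fun i => val (f i))); last by move=> i; rewrite ffunE.
move=> /andP[mf /existsP[i]]; rewrite ffunE => /eqP fx.
pose u := motif_vec pi (fun i => val (f i)).
have fu := agrees_motif_vec pi_part piP _ mf.
(* With no light index besides [i], [u] would be a center, hence [v], and [x] would be in line with
   [v]. *)
have [j ji ju] : exists2 j, j != i & (M L * agree_count S (fvec u j) < #|` S|)%N.
  apply/exists_inP; apply: contraT; rewrite negb_exists_in => /forall_inP h.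
  suff /uniq_v uv : is_center S u by move: (nx i); rewrite -uv -fx fu.
  apply/centerP => j k jk; have [ji|ji] := eqVneq j i.
    by right; rewrite leqNgt h // -ji eq_sym.
  by left; rewrite leqNgt h.
exists (i, j); rewrite inE /= mf ji -(agree_count_line pi_part piP _ (fu j)) (ltnW ju).
by rewrite /= !andbT; apply/eqP; apply: val_inj.
Qed.

(* If x is off the lines of v, moving it to a new position on one of them
   increases the number of motifs. *)
Lemma maximal_in_line S v : (0 < #|` S|)%N -> maximal S -> is_hypercenter S v ->
  (forall u, is_center S u -> u = v) -> forall x, x \in S -> in_line v x.
Proof.
move=> S_gt0 maxS /hypercenterP hv uniq_v x xS.
have [/existsP[i]|] := boolP [exists i, agrees (fvec v i) x]; first by exists i.
rewrite negb_exists => /forallP nx; exfalso.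
pose i0 := Ordinal L_gt0; have [t tP] := coord_ub S (s i0).
(* The replacement for [x]: on the line of [v] at [i0], beyond all of [S] in the free coordinate. *)
pose y : point := \row_m (if m == s i0 then t else line_base v i0 0 m).
have yS : y \notin S by apply/negP => /tP; rewrite mxE eqxx ltxx.
have yv : agrees (fvec v i0) y.
  by rewrite (agreesE pi_part piP); apply/on_lineP => m /negPf mi; rewrite mxE mi.
pose S' := y |` (S `\ x).
have S'S : #|` S'| = #|` S|.
  by rewrite cardfsU1 !inE (negPf yS) andbF [RHS](cardfsD1 x) xS.
pose lost := [fset f in motifs pi S | [exists i, f i == x]].
have lostE f : (f \in lost) = (f \in motifs pi S) && [exists i, f i == x].
  by rewrite !inE.
(* Gained motifs: [y] at [i0], the other points free on the lines of [v]. *)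
pose P i := if i == i0 then xpred1 y else agrees (fvec v i).
pose gain := [fset f in tuples 'I_L S' | [forall i, P i (f i)]].
have gainP f : f \in gain -> f i0 = y /\ f \in motifs pi S'.
  rewrite !inE => /andP[-> /forallP h] /=; have := h i0; rewrite /P eqxx => /eqP fy.
  split => //; apply: (agrees_motif pi_part piP (v := v)) => i.
  by have := h i; rewrite /P; case: eqP => [-> /eqP ->|].
have kept_gain : (#|` motifs pi S `\` lost| + #|` gain| <= #|` motifs pi S'|)%N.
  rewrite -cardfsUI (_ : (_ `&` gain) = fset0) ?cardfs0 ?addn0; last first.
    apply/fsetP => f; rewrite in_fsetI in_fset0; apply/negP => /andP[+ /gainP[fy _]].
    rewrite in_fsetD in_motifs => /and3P[_ /forallP/(_ i0)].
    by rewrite fy (negPf yS).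
  apply/fsubset_leq_card/fsubsetP => f; rewrite in_fsetU => /orP[|/gainP[]//].
  rewrite in_fsetD lostE => /andP[+ fS]; rewrite fS /= negb_exists => /forallP fx.
  move: fS; rewrite !in_motifs => /andP[/forallP fS ->]; rewrite andbT.
  by apply/forallP => i; rewrite !inE fx fS orbT.
have gain_lost : (#|` gain| <= #|` lost|)%N.
  have := maxS.2 S' S'S; rewrite !motif_countE => /(leq_trans kept_gain).
  by rewrite -(cardfsID lost (motifs pi S)) addnC leq_add2r => /leq_trans; apply;
     apply/fsubset_leq_card/fsubsetIr.
(* No line of [v] contains [x], so each keeps its at least [r / M1 L] points in [S']. *)
have gain_ge : (#|` S| ^ (L - 1) <= M1 L ^ (L - 1) * #|` gain|)%N.
  rewrite card_tuples_family (bigD1 i0) //=.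
  have PE q : (q ^ (L - 1) = \prod_(j < L | j != i0) q)%N.
    by rewrite prod_nat_const cardC1 card_ord subn1.
  have y1 : (0 < #|[set z : S' | P i0 (val z)]%SET|)%N.
    rewrite card_gt0; apply/set0Pn; have yS' : y \in S' by rewrite !inE eqxx.
    by exists [` yS']; rewrite inE /P eqxx /=.
  apply: leq_trans (leq_mul (leqnn _) (leq_pmull _ y1)).
  rewrite !PE -big_split /=; apply: leq_prod => i /negPf ii0.
  apply: leq_trans (hv i) _; rewrite leq_mul2l; apply/orP; right.
  rewrite /P ii0 -agree_countE; apply/fsubset_leq_card/fsubsetP => z.
  rewrite !inE => /andP[zS zv]; rewrite zS zv !andbT; apply/orP; right.
  by apply: contraTneq zv => ->.
have gain_gt0 : (0 < #|` gain|)%N.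
  rewrite lt0n; apply: contraTneq gain_ge => ->.
  by rewrite muln0 -ltnNge expn_gt0 S_gt0.
have lost_le := card_motifs_through xS uniq_v nx.
(* This contradicts [M L > (2 * M1 L)^(L-1) * L^2]. *)
have : (M L * #|` gain| <= L ^ 2 * (M1 L ^ (L - 1) * #|` gain|))%N.
  apply: leq_trans (leq_mul (leqnn _) gain_lost) _; apply: leq_trans lost_le _.
  by rewrite leq_mul2l gain_ge orbT.
rewrite mulnA leq_pmul2r // leqNgt /M addn1 ltnS expnMn mulnC.
by rewrite leq_mul2r -[X in (X <= _)%N]mul1n leq_mul2r expn_gt0 !orbT.
Qed.

End Centers.

(* The limit and the structure of maximal sets *)
From mathcomp Require Import classical_sets topology normedtype.
Import numFieldNormedType.Exports.

Theorem theorem5 (R : realType) (p L : nat) (hL : (0 < L)%N)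
    (pi : 'I_p -> {set {set 'I_L}}) (hpi : single_starred pi) :
  exists maxM : nat -> nat,
    [/\ (forall r : nat, is_max_motif_count R pi r (maxM r)),
        (((maxM r)%:R / (motif_const R pi * r%:R ^+ L) : R)%R
          @[r --> \oo] --> (1 : R)%R)%classic
      & exists r0 : nat,
          forall (r : nat) (S : {fset 'rV[R]_p}),
            (r0 <= r)%N -> #|` S| = r -> motif_count pi S = maxM r ->
            (exists v : {ffun block pi -> R},
               [/\ unique (fun u : {ffun block pi -> R} => is_center S u) v,
                   is_hypercenter S v
                 & forall x : 'rV[R]_p, x \in S -> in_line v x])
            /\
            (exists c : 'I_p -> 'rV[R]_p,
               forall x : 'rV[R]_p, x \in S ->
                 exists2 j : 'I_p, j \in starred pi &
                   forall m : 'I_p, m != j -> x 0 m = c j 0 m)].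
Proof.
have [pi_part pi_star] := hpi.
have /boolp.choice[s sP] : forall i, exists m0, forall m, ([set i]%SET \in pi m) = (m == m0).
  move=> i; have [m [im um]] := pi_star i; exists m => m'.
  by apply/idP/eqP => [/um -> //|->].
have [maxM maxP] := boolp.choice (fun r => max_motif_count_ex R pi_part sP r hL).
exists maxM; split=> //.
  have C_gt0 := motif_const_gt0 R sP hL.
  apply/cvgrPdist_le => e e_gt0; have Ce : 0 < motif_const R pi * e by rewrite mulr_gt0.
  have [r1 r1P] := motif_count_max_ge pi_part sP hL Ce.
  have [K [r2 [_ r2P]]] := motif_count_add_le pi_part sP hL 0 Ce.
  exists (maxn 1 (maxn r1 r2)) => // r /=; rewrite !geq_max => /and3P[r_gt0 rr1 rr2].
  have [[S [Sr Sn]] _] := maxP r; have lb := r1P _ _ rr1 (maxP r).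
  have ub : (maxM r)%:R <= (motif_const R pi + motif_const R pi * e) * r%:R ^+ L.
    (* The plain upper bound is the case of no added non-motifs. *)
    have := r2P S finset.set0; rewrite Sr Sn cards0 addn0; apply=> // [f|f i]; by rewrite inE.
  have D_gt0 : 0 < motif_const R pi * r%:R ^+ L by rewrite mulr_gt0 // exprn_gt0 // ltr0n.
  rewrite ler_distlC; apply/andP; split.
    rewrite ler_pdivlMr //; lra.
  rewrite ler_pdivrMr //; lra.
have [r1 r1P] := hypercenter_ex R pi_part sP hL.
have [r2 r2P] := center_hypercenter_eq R pi_part sP hL.
have [r3 r3P] := hypercenter_line_eq R pi_part sP hL.
exists (maxn (maxn 1 r1) (maxn r2 r3)) => r S; rewrite !geq_max.
move=> /andP[/andP[r_gt0 rr1] /andP[rr2 rr3]] Sr SM; rewrite -Sr in r_gt0 rr1 rr2 rr3.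
have maxS : is_max_motif_count R pi #|` S| (motif_count pi S) by rewrite SM Sr.
have [v hv] := r1P S rr1 maxS.
have vline := maximal_in_line pi_part sP hL r_gt0 maxS hv (fun u => r2P S u v rr2 maxS hv).
split.
  exists v; split=> //; split; first exact: hypercenter_center hv.
  by move=> u /(r2P S u v rr2 maxS hv).
(* Any [i] with [s i = j] serves, as lines of [v] of equal direction coincide; the default 0 occurs
   only for directions that are not starred. *)
exists (fun j => if [pick i | s i == j] is Some i then line_base v i else 0) => x /vline[i].
rewrite (agreesE pi_part sP) => /on_lineP vx.
exists (s i); first by rewrite (starredE sP); apply/existsP; exists i.
move=> m mi; rewrite vx //; case: pickP => [j /eqP ji|/(_ i)]; last by rewrite eqxx.
by rewrite (r3P S v i j rr3 maxS hv).
Qed.
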